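(* Let $G$ be a non-discrete Hausdorff topological group, and let $\kappa > 0$ be a cardinal. Suppose that $G$ contains a dense free subgroup $F$ of rank $\kappa$. Then $G$ is almost $\kappa$-free. Moreover, if $2 \leq \kappa \leq \aleph_0$, then $G$ is almost countably free.
   Context: For a cardinal $\kappa>0$ and a group $G$, let $G_\kappa$ denote the set of $\kappa$-tuples $(g_i)_{i\in\kappa}\in G^\kappa$ that freely generate a free subgroup of $G$, i.e. such that no nontrivial reduced group word in the indexed variables $(x_i)_{i\in\kappa}$ evaluates to $1$ at $(g_i)_{i\in\kappa}$ (equivalently, the homomorphism from the free group on $\{x_i\}_{i\in\kappa}$ to $G$ sending $x_i\mapsto g_i$ is injective). An infinite topological group $G$ is called almost $\kappa$-free if $G_\kappa$ is dense in $G^\kappa$ with the product topology (a finite topological group is not almost $\kappa$-free). ''Almost countably free'' means almost $\aleph_0$-free. *)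

(* Defs.v *)
From HB Require Import structures.
From mathcomp Require Import all_boot.
From mathcomp Require Import boolp classical_sets functions cardinality.
From mathcomp Require Import topology.

Set Implicit Arguments.
Unset Strict Implicit.
Unset Printing Implicit Defensive.

Local Open Scope classical_set_scope.
Local Open Scope group_scope.

HB.mixin Record isTopologicalGroup G & Topological G & Group G := {
  mulg_continuous : continuous (fun xy : G * G => xy.1 * xy.2) ;
  invg_continuous : continuous (fun x : G => x^-1)
}.

#[short(type="topologicalGroupType")]
HB.structure Definition TopologicalGroup :=
  {G of Topological G & Group G & isTopologicalGroup G}.

Definition is_discrete (T : topologicalType) : Prop :=
  forall A : set T, open A.

(* A group word over K lists its letters from left to right;
   (i, false) stands for x_i and (i, true) for x_i^-1. *)
Definition word (K : Type) : Type := seq (K * bool).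

Definition reduced (K : Type) (w : word K) : Prop :=
  forall (u v : word K) (i : K) (b : bool),
    w <> u ++ [:: (i, b), (i, ~~ b) & v].

Definition word_eval (K : Type) (G : groupType) (g : K -> G) (w : word K) : G :=
  \prod_(l <- w) (if l.2 then (g l.1)^-1 else g l.1).

Definition freely_generates (K : Type) (G : groupType) (g : K -> G) : Prop :=
  forall w : word K, reduced w -> w <> [::] -> word_eval g w <> 1.

Definition is_subgroup (G : groupType) (H : set G) : Prop :=
  group_closed [in H].

Definition generated_subgroup (G : groupType) (A : set G) : set G :=
  smallest (@is_subgroup G) A.

(* Cardinals are represented by types: K stands for the cardinality of
   [set: K]. *)
Definition free_subgroup_of_rank (K : Type) (G : groupType) (F : set G) : Prop :=
  exists g : K -> G, freely_generates g /\ F = generated_subgroup (range g).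

(* G_kappa as a subset of G^kappa; {ptws K -> G} carries the product
   topology. *)
Definition free_tuples (K : Type) (G : topologicalGroupType) :
    set {ptws K -> G} :=
  [set g | freely_generates g].

Definition almost_free (K : Type) (G : topologicalGroupType) : Prop :=
  infinite_set [set: G] /\ dense (@free_tuples K G).

Definition almost_countably_free (G : topologicalGroupType) : Prop :=
  almost_free nat G.

(* Main.v *)
(* Let F be freely generated by f and let x <> y be two of its free generators.
   An arbitrary nontrivial v in F close to 1 has a conjugate of the form
   q v q^-1, with q among x, x^-1, y, y^-1, which remains reduced when conjugated
   further by a fixed positive word c: of the four letters at most three are
   excluded by the last letter of c and the two ends of v.  As c and q range over
   a finite set fixed before v, the reduced word T = c q v q^-1 c^-1 can be made
   as close to 1 as desired, and both T and T^-1 send every reduced word outside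
   the cylinder [c] into [c].  Given words a_j evaluating near the target tuple,
   almost all empty and all of length < n, put g_j = T_j a_j T'_j for the
   cylinders of c_j = x^n y d_j and c'_j = x^(2n) y d_j, where (d_j) is a prefix
   code.  Multiplication by a_j^{+-1} is too short to connect [c_j] with [c'_j],
   so the g_j play ping-pong on reduced words and are free.
   In rank one, any nontrivial element of F generates a free group. *)

Require Import Defs.
From mathcomp Require Import all_boot.
From mathcomp Require Import boolp classical_sets functions cardinality.
From mathcomp Require Import topology.
From mathcomp Require Import zify.

Local Open Scope classical_set_scope.
Local Open Scope card_scope.

Set Implicit Arguments.
Unset Strict Implicit.
Unset Printing Implicit Defensive.

(** * Reduced words and left multiplication on them *)

Section Words.
Variable K : eqType.
Implicit Types (l : K * bool) (u v w : word K).

Definition linv l : K * bool := (l.1, ~~ l.2).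

Definition nocancel : rel (K * bool) := fun l l' => l' != linv l.

Definition winv w : word K := rev (map linv w).

(** Left multiplication by one letter with cancellation. Folded over the letters of [u], it makes
    [u] act on reduced words, which thus serve as a model of the free group. *)
Definition push l w : word K :=
  if w is l' :: w' then if l' == linv l then w' else l :: w else [:: l].

Local Notation act u w := (foldr push w u).

Lemma linvK : involutive linv.
Proof. by case=> i b; rewrite /linv /= negbK. Qed.

Lemma reducedP w : reduced w <-> sorted nocancel w.
Proof.
split=> [|sw u v i b ewuv].
  elim: w => // l [|l' w] //= IHw red_w; apply/andP; split.
    apply/eqP=> l'E; apply: (red_w [::] w l.1 l.2).
    by rewrite l'E; case: (l).
  by apply: IHw => u v i b E; apply: (red_w (l :: u) v i b); rewrite E.
move: sw; rewrite ewuv sorted_cat_cons => /andP[_] /=.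
by rewrite /nocancel /linv /= eqxx.
Qed.

Lemma sorted_winv w : sorted nocancel (winv w) = sorted nocancel w.
Proof.
rewrite /winv rev_sorted sorted_map; apply: eq_sorted => l l' /=.
by rewrite /nocancel linvK eq_sym.
Qed.

Lemma winv_cat u v : winv (u ++ v) = winv v ++ winv u.
Proof. by rewrite /winv map_cat rev_cat. Qed.

Lemma winvK : involutive winv.
Proof. by move=> w; rewrite /winv map_rev revK (mapK linvK). Qed.

Lemma size_winv w : size (winv w) = size w.
Proof. by rewrite size_rev size_map. Qed.

Lemma act_cat u v w : act (u ++ v) w = act u (act v w).
Proof. exact: foldr_cat. Qed.

Lemma push_sorted l w : sorted nocancel w -> sorted nocancel (push l w).
Proof.
case: w => //= l' w; case: ifP => [_ /path_sorted //|l'l /= ->].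
by rewrite /nocancel l'l.
Qed.

Lemma act_sorted u w : sorted nocancel w -> sorted nocancel (act u w).
Proof. by move=> sw; elim: u => //= l u; exact: push_sorted. Qed.

Lemma act_reduced u w : sorted nocancel (u ++ w) -> act u w = u ++ w.
Proof.
elim: u => //= l u IHu suw; rewrite IHu; last exact: path_sorted suw.
by case: (u ++ w) suw => //= l' v /andP[/negPf->].
Qed.

(* Left multiplication by u alters only a prefix of w, by at most [size u]
   letters in total. *)
Lemma act_near u w : exists u' w' v,
  [/\ act u w = u' ++ v, w = w' ++ v & size u' + size w' <= size u].
Proof.
elim: u => [|l u [u' [w' [v [E wE le_uw]]]]]; first by exists [::], [::], w.
move: E; rewrite wE => E; rewrite /= {}E {w wE}.
case: u' le_uw => [|l' u'] /= le_uw.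
  case: v => [|l' v] /=; first by exists [:: l], w', [::].
  case: ifP => _; last by exists [:: l], w', (l' :: v).
  exists [::], (rcons w' l'), v; split=> //; first by rewrite cat_rcons.
  by rewrite size_rcons.
case: ifP => _; first by exists u', w', v; split=> //; lia.
by exists (l :: l' :: u'), w', v.
Qed.

Lemma sorted_cat_head u l v w : sorted nocancel (u ++ l :: v) ->
  sorted nocancel (l :: w) -> sorted nocancel (u ++ l :: w).
Proof. by rewrite !sorted_cat_cons => /andP[-> _]. Qed.

Lemma winv_rcons u l : winv (rcons u l) = linv l :: winv u.
Proof. by rewrite /winv map_rcons rev_rcons. Qed.

Lemma winv_cons u l : winv (l :: u) = winv u ++ [:: linv l].
Proof. by rewrite -cat1s winv_cat. Qed.

(** The inverse of [rcons u l] cancels only against the common prefix of [rcons u l] and [w]. That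
    prefix is proper, so the leftmost letter [linv l] of the inverse survives. *)
Lemma act_winv_nprefix u l w : sorted nocancel (rcons u l) ->
  sorted nocancel w -> ~~ prefix (rcons u l) w ->
  exists v, act (winv (rcons u l)) w = linv l :: v.
Proof.
elim: u w => [|k u IHu] w.
  case: w => [|l' w] /=; first by exists [::].
  rewrite linvK prefix0s andbT eq_sym => _ _ /negPf ->; by exists (l' :: w).
rewrite rcons_cons winv_cons act_cat /= => suk sw npre.
(* Either [w] begins with [k] and the induction continues after one cancellation, or nothing cancels
   at all. *)
have [[w' wE]|nkw] : (exists w', w = k :: w') \/ push (linv k) w = linv k :: w.
- case: w {sw npre} => [|k' w] /=; first by right.
  by rewrite linvK; case: eqP => [->|]; [left; exists w|right].
- rewrite wE /= linvK eqxx; apply: IHu; first exact: path_sorted suk.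
    by move: sw; rewrite wE => /path_sorted.
  by move: npre; rewrite wE /= eqxx.
have snkw : sorted nocancel (linv k :: w) by rewrite -nkw push_sorted.
rewrite nkw act_reduced; first by rewrite winv_rcons; eexists.
apply: (sorted_cat_head (v := [::])) snkw.
by rewrite -winv_cons sorted_winv.
Qed.

(** After [winv u] has acted, the word begins with the first letter of [winv u]. Since [u ++ m] is
    reduced against that letter, it is then prepended without cancellation. *)
Lemma act_conj_prefix u m w : u <> [::] -> m <> [::] ->
  sorted nocancel (u ++ m ++ winv u) ->
  sorted nocancel w -> ~~ prefix u w -> prefix u (act (u ++ m ++ winv u) w).
Proof.
case/lastP: u => // u l _ _ suml sw npre.
have su : sorted nocancel (rcons u l) by have [] := cat_sorted2 suml.
have [v vE] := act_winv_nprefix su sw npre.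
rewrite catA act_cat vE act_reduced; first by rewrite -catA prefix_prefix.
move: suml; rewrite winv_rcons catA => /sorted_cat_head; apply.
by rewrite -vE act_sorted.
Qed.

Lemma winv_conj u m : winv (u ++ m ++ winv u) = u ++ winv m ++ winv u.
Proof. by rewrite !winv_cat winvK catA. Qed.

Lemma reduced_conjugation x y u l v : x != y -> sorted nocancel (rcons u l) ->
  v <> [::] -> sorted nocancel v ->
  exists2 q, q \in [:: (x, false); (x, true); (y, false); (y, true)] &
    sorted nocancel (rcons u l ++ (q :: rcons v (linv q)) ++ winv (rcons u l)).
Proof.
move=> xy su; case: v => // a v _ sv.
(* The excluded letters are those for which [q] would cancel [l] or the first letter of [v], or
   [linv q] the last letter of [v]. The junction of [linv q] with [linv l] repeats the first
   condition. *)
have /allPn[q q4 qN] : ~~ all [in [:: linv l; linv a; last a v]]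
   [:: (x, false); (x, true); (y, false); (y, true)].
  apply/negP => /allP /uniq_leq_size.
  by rewrite /= !inE !xpair_eqE !eqxx (negPf xy) /= => /(_ isT).
exists q => //; move: qN; rewrite !inE !negb_or => /and3P[ql qa qb].
rewrite -cat1s -!catA cat1s sorted_cat_cons -cats1 cat_rcons sorted_cat_cons su.
rewrite rcons_cons -cats1 /= -catA cat_path /= [path _ a v]sv.
move: su; rewrite -sorted_winv winv_rcons /= => ->.
have aq : a != linv q by rewrite eq_sym (can2_eq linvK linvK).
by rewrite /nocancel linvK (inj_eq (can_inj linvK)) ql aq qb eq_sym ql.
Qed.

(** * Ping-pong on reduced words *)

Section PingPong.
Variables (L : Type) (W : L -> word K) (C : L * bool -> pred (word K)).

Definition subst (k : L * bool) : word K := if k.2 then winv (W k.1) else W k.1.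

Hypothesis C_nil : forall k, ~~ C k [::].
Hypothesis C_disj : forall k k' w, C k w -> C k' w -> k = k'.
Hypothesis C_act : forall k w, sorted nocancel w ->
  ~~ C (k.1, ~~ k.2) w -> C k (act (subst k) w).

(** By induction the tail lands in the set of its first letter. As the word is reduced, this letter
    is not the inverse of [k], so by disjointness the tail avoids the set of that inverse and [k]
    may act. *)
Lemma ping_pong k (w : word L) : reduced (k :: w) ->
  C k (act (flatten (map subst (k :: w))) [::]).
Proof.
elim: w k => [|k' w IHw] k red_w; first by rewrite /= cats0 C_act.
rewrite -[map _ _]/(subst k :: map subst (k' :: w)) /= -/(flatten _) act_cat.
apply: C_act; first exact: act_sorted.
have red_k'w : reduced (k' :: w).
  by move=> u v i b wE; apply: (red_w (k :: u) v i b); rewrite wE.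
apply/negP => /C_disj /(_ (IHw k' red_k'w)) E.
apply: (red_w [::] w k.1 k.2); rewrite /= E; first by case: (k).
Qed.
End PingPong.

(* The letter y at position n of the first word would lie in the common tail v,
   hence in the x-block of the second. *)
Lemma prefix_overlap (x y : K * bool) n (r u' w' v : word K) : x != y ->
  size u' + size w' < n ->
  prefix (nseq n x ++ y :: r) (u' ++ v) -> prefix (nseq n.*2 x) (w' ++ v) -> False.
Proof.
move=> xy lt_n /prefixP[s1 E1] /prefixP[s2 E2].
have: nth x (u' ++ v) n = y.
  by rewrite E1 -catA nth_cat size_nseq ltnn subnn.
have: nth x (w' ++ v) (size w' + (n - size u')) = x.
  rewrite E2 nth_cat size_nseq ifT; last lia.
  by rewrite nth_nseq if_same.
rewrite !nth_cat ifN; last lia.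
rewrite ifN; last lia.
by rewrite addKn => -> E; rewrite E eqxx in xy.
Qed.

End Words.

(** * Evaluation of words in a group *)

Section WordEval.
Variables (K : eqType) (G : groupType) (f : K -> G).
Implicit Types (u v w : word K).
Local Open Scope group_scope.

Lemma word_eval_nil : word_eval f [::] = 1.
Proof. exact: big_nil. Qed.

Lemma word_eval_cat u v : word_eval f (u ++ v) = word_eval f u * word_eval f v.
Proof. exact: big_cat. Qed.

Lemma word_eval_cons l w : word_eval f (l :: w) = word_eval f [:: l] * word_eval f w.
Proof. by rewrite -cat1s word_eval_cat. Qed.

Lemma word_eval_linv l : word_eval f [:: linv l] = (word_eval f [:: l])^-1.
Proof. by rewrite /word_eval !big_seq1; case: l => i [] //=; rewrite invgK. Qed.

Lemma word_eval_winv w : word_eval f (winv w) = (word_eval f w)^-1.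
Proof.
elim: w => [|l w IHw]; first by rewrite /winv word_eval_nil invg1.
by rewrite winv_cons word_eval_cat IHw word_eval_linv (word_eval_cons l w) invgM.
Qed.

Lemma word_eval_push l w : word_eval f (push l w) = word_eval f (l :: w).
Proof.
case: w => //= l' w; case: eqP => // ->.
by rewrite !(word_eval_cons _ (_ :: _), word_eval_cons _ w) word_eval_linv mulVKg.
Qed.

Lemma word_eval_act u w :
  word_eval f (foldr (@push K) w u) = word_eval f u * word_eval f w.
Proof.
elim: u => [|l u IHu] /=; first by rewrite word_eval_nil mul1g.
by rewrite word_eval_push word_eval_cons IHu mulgA -word_eval_cons.
Qed.

Lemma word_eval_sorted w :
  exists2 v, sorted (@nocancel K) v & word_eval f v = word_eval f w.
Proof.
exists (foldr (@push K) [::] w); first exact: act_sorted.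
by rewrite word_eval_act word_eval_nil mulg1.
Qed.

Lemma word_eval_subst (L : Type) (W : L -> word K) (w : word L) :
  word_eval (fun j => word_eval f (W j)) w =
  word_eval f (flatten (map (subst W) w)).
Proof.
elim: w => [|k w IHw]; first by rewrite /= word_eval_nil /word_eval big_nil.
rewrite /= word_eval_cat -IHw /word_eval big_cons; congr (_ * _).
by rewrite /subst; case: ifP => // _; rewrite -/(word_eval f _) -word_eval_winv.
Qed.

(** The values of words form a subgroup containing the generators. *)
Lemma generated_word_eval (e : G) :
  generated_subgroup (range f) e -> exists w, word_eval f w = e.
Proof.
move=> /(_ [set e | exists w, word_eval f w = e]); apply.
split.
- rewrite /is_subgroup /group_closed; split.
    by apply/mem_set; exists [::]; rewrite word_eval_nil.
  move=> _ _ /set_mem[wu <-] /set_mem[wv <-]; apply/mem_set.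
  by exists (wu ++ winv wv); rewrite word_eval_cat word_eval_winv.
- by move=> _ [i _ <-]; exists [:: (i, false)]; rewrite /word_eval big_seq1.
Qed.

End WordEval.

(** Ping-pong puts the reduced form of a substituted word into a set that omits the empty word.
    Being nonempty, it has a nontrivial value under the free family [f]. *)
Lemma ping_pong_free (K : eqType) (L : Type) (G : groupType) (f : K -> G)
    (W : L -> word K) (C : L * bool -> pred (word K)) :
  freely_generates f ->
  (forall k, ~~ C k [::]) ->
  (forall k k' w, C k w -> C k' w -> k = k') ->
  (forall k w, sorted (@nocancel K) w -> ~~ C (k.1, ~~ k.2) w ->
     C k (foldr (@push K) w (subst W k))) ->
  freely_generates (fun j => word_eval f (W j)).
Proof.
move=> free_f C_nil C_disj C_act [//|k w] red_kw _; rewrite word_eval_subst.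
have := ping_pong C_nil C_disj C_act red_kw; set u := flatten _ => Cu.
have -> : word_eval f u = word_eval f (foldr (@push K) [::] u).
  by rewrite word_eval_act word_eval_nil mulg1.
apply: free_f; first by apply/reducedP; exact: act_sorted.
by move=> E; move: Cu; rewrite E (negPf (C_nil _)).
Qed.

Lemma sorted_positive (K : eqType) (s : seq K) :
  sorted (@nocancel K) [seq (i, false) | i <- s].
Proof.
by elim: s => // i [|j s] //= ->; rewrite /nocancel /linv xpair_eqE andbF.
Qed.

(** * Cylinders and freeness of the perturbed tuple *)

Section Perturbation.
Variables (K : eqType) (L : Type) (x y : K) (d : L -> seq K) (n : nat).
Hypothesis xy : x != y.
Hypothesis d_code : forall i j u v, d i ++ u = d j ++ v -> i = j.

(** These are the words c_j (for [false]) and c'_j (for [true]): g_j will map into [c_j] and its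
    inverse into [c'_j]. *)
Definition cylinder (k : L * bool) : word K :=
  [seq (i, false) | i <- nseq (if k.2 then n.*2 else n) x ++ y :: d k.1].

Lemma cylinderE k : cylinder k =
  nseq (if k.2 then n.*2 else n) (x, false) ++ (y, false) ::
    [seq (i, false) | i <- d k.1].
Proof. by rewrite /cylinder map_cat map_nseq. Qed.

Lemma cylinder_neq0 k : cylinder k <> [::].
Proof. by rewrite cylinderE; case: (nseq _ _). Qed.

Lemma cylinder_sorted k : sorted (@nocancel K) (cylinder k).
Proof. exact: sorted_positive. Qed.

(** The different lengths of the [x]-blocks already separate the two kinds of cylinder, whatever the
    code words; hence [j'] is arbitrary. *)
Lemma cylinder_far k j' u' w' v : size u' + size w' < n ->
  prefix (cylinder k) (u' ++ v) ->
  ~~ prefix (cylinder (j', ~~ k.2)) (w' ++ v).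
Proof.
have xyl : (x, false) != (y, false) by rewrite xpair_eqE andbT.
move=> lt_n; rewrite !cylinderE; case: k => j [] /= pk; apply/negP => pk'.
  by apply: (prefix_overlap xyl _ pk' (catl_prefix pk)); rewrite addnC.
exact: (prefix_overlap xyl lt_n pk (catl_prefix pk')).
Qed.

Lemma cylinder_disj k k' w : 0 < n ->
  prefix (cylinder k) w -> prefix (cylinder k') w -> k = k'.
Proof.
case: k k' => [j b] [j' b'] n_gt0; have [->|b'b] := eqVneq b b'; last first.
  have -> : b' = ~~ b by case: b b' b'b => [] [].
  (* With both altered prefixes empty, the size condition is just [0 < n]. *)
  by move=> /(@cylinder_far (j, b) j' [::] [::] w n_gt0) /negP.
rewrite !cylinderE /= => /prefixP[s ->] /prefixP[s'].
rewrite -!catA => /eqP; rewrite eqseq_cat // eqxx /= eqseq_cons eqxx /=.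
move=> /eqP /(congr1 (map fst)); rewrite !map_cat -!map_comp !map_id.
by move=> /d_code ->.
Qed.

Definition conjugated (k : L * bool) (m : word K) : word K :=
  cylinder k ++ m ++ winv (cylinder k).

Lemma act_conjugated k m w : m <> [::] -> sorted (@nocancel K) (conjugated k m) ->
  sorted (@nocancel K) w -> ~~ prefix (cylinder k) w ->
  prefix (cylinder k) (foldr (@push K) w (conjugated k m)).
Proof. by move=> m0; apply: act_conj_prefix m0; exact: cylinder_neq0. Qed.

Definition perturbed (m : L * bool -> word K) (a : L -> word K) (j : L) : word K :=
  conjugated (j, false) (m (j, false)) ++ a j ++
  conjugated (j, true) (m (j, true)).

Lemma perturbed_free (G : groupType) (f : K -> G) m a : freely_generates f ->
  (forall j, size (a j) < n) -> (forall k, m k <> [::]) ->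
  (forall k, sorted (@nocancel K) (conjugated k (m k))) ->
  freely_generates (fun j => word_eval f (perturbed m a j)).
Proof.
move=> free_f a_lt m_neq0 m_sorted.
apply: (@ping_pong_free _ _ _ _ _ (fun k => prefix (cylinder k))) => //.
- by move=> k; apply/negP; rewrite prefixs0 => /eqP/cylinder_neq0.
- by move=> k k' w; apply: cylinder_disj; apply: leq_ltn_trans (a_lt k.1).
(* One form serves both signs, since inverting g_j swaps its outer factors. The right factor moves
   [w] into one cylinder, the short middle factor cannot reach the opposite one, and the left factor
   then maps into the latter. *)
have stepP k w m1 b m2 : m1 <> [::] -> sorted (@nocancel K) (conjugated k m1) ->
    m2 <> [::] -> sorted (@nocancel K) (conjugated (k.1, ~~ k.2) m2) ->
    size b < n -> sorted (@nocancel K) w ->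
    ~~ prefix (cylinder (k.1, ~~ k.2)) w ->
  prefix (cylinder k) (foldr (@push K) w
    (conjugated k m1 ++ b ++ conjugated (k.1, ~~ k.2) m2)).
  move=> m10 sm1 m20 sm2 ltb sw npre; rewrite act_cat.
  apply: act_conjugated => //; first exact: act_sorted.
  have := act_conjugated m20 sm2 sw npre; rewrite act_cat; set z := foldr _ _ _.
  have [u' [w' [v [-> -> le_b]]]] := act_near b z => pz.
  have := @cylinder_far (k.1, ~~ k.2) k.1 w' u' v _ pz; rewrite /= negbK.
  case: (k) => j c; apply => /=; lia.
have winv_neq0 (w : word K) : w <> [::] -> winv w <> [::].
  by move=> w0 /(congr1 (@winv K)); rewrite winvK.
have winv_conjugated k w : winv (conjugated k w) = conjugated k (winv w).
  exact: winv_conj.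
move=> [j []] w sw npre; rewrite /subst /perturbed /=.
  rewrite winv_cat (winv_cat (a j)) !winv_conjugated -catA.
  apply: (stepP (j, true)) => //=; rewrite ?size_winv //.
  - exact: winv_neq0.
  - by rewrite -winv_conjugated sorted_winv.
  - exact: winv_neq0.
  - by rewrite -winv_conjugated sorted_winv.
exact: (stepP (j, false)).
Qed.

End Perturbation.

(** * Basic neighbourhoods in the product topology *)

Lemma nbhs_ptws_box (I : Type) (T : topologicalType) (u : {ptws I -> T})
    (O : set {ptws I -> T}) : nbhs u O ->
  exists (s : seq {classic I}) (U : I -> set T),
    (forall i, open_nbhs (u i) (U i)) /\
    (forall g, (forall i, (i : {classic I}) \in s -> U i (g i)) -> O g).
Proof.
pose box : set_system {ptws I -> T} := [set A |
  exists (s : seq {classic I}) (U : I -> set T),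
    (forall i, open_nbhs (u i) (U i)) /\
    (forall g, (forall i, (i : {classic I}) \in s -> U i (g i)) -> A g)].
(* The product topology is a supremum of topologies pulled back along the coordinates, so
   convergence of the filter of boxes can be checked one coordinate at a time. *)
suff : box --> u by apply.
have box_filter : Filter box.
  split.
  - by exists [::], (fun=> setT); split=> // i; split=> //; exact: openT.
  - move=> A B [s [U [oU sA]]] [s' [U' [oU' s'B]]].
    exists (s ++ s'), (fun i => U i `&` U' i); split=> [i|g gUU'].
      have [[? ?] [? ?]] := (oU i, oU' i).
      by split; [exact: openI|split].
    by split; [apply: sA => i si|apply: s'B => i si];
      have [] := gUU' i; rewrite // mem_cat si ?orbT.
  - move=> A B AB [s [U [oU sA]]]; exists s, U; split=> // g gU.
    exact/AB/sA.
apply/cvg_sup => i A; rewrite nbhsE => -[_ [[B oB <-] Bui] BA].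
exists [:: i : {classic I}], (fun j => [set z | j = i -> B z]); split=> [j|g].
  have [->|ji] := pselect (j = i).
    rewrite (_ : [set z | _] = B) //; apply/seteqP.
    by split=> z /= Bz // ; exact: Bz.
  rewrite (_ : [set z | _] = setT); first by split=> //; exact: openT.
  by apply/seteqP; split=> // z _ /ji.
by move=> /(_ i); rewrite mem_head => /(_ isT erefl) /BA.
Qed.

(** * Hausdorff non-discrete groups *)

Section TopologicalGroup.
Variable G : topologicalGroupType.
Local Open Scope group_scope.

Lemma mulg_cvg (T : Type) (D : set_system T) (p q : T -> G) (a b : G) :
  Filter D -> p @ D --> a -> q @ D --> b ->
  (fun t => p t * q t) @ D --> a * b.
Proof.
move=> FD; apply: (@continuous2_cvg _ _ _ _ _ _ _ _ (fun a b : G => a * b)).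
exact: (@mulg_continuous G (a, b)).
Qed.

(** A left translation carries any given point to [e], so all singletons are open. *)
Lemma is_discrete_open1 (e : G) : open [set e] -> is_discrete G.
Proof.
move=> oe A.
have o1 z : open [set z : G].
  rewrite (_ : [set z] = (fun v => (e * z^-1) * v) @^-1` [set e]); last first.
    apply/seteqP; split=> v /= => [->|E]; first by rewrite mulgVK.
    by apply/eqP; rewrite -(inj_eq (mulgI (e * z^-1))) E mulgVK.
  apply: open_comp => // v _; apply: mulg_cvg; [exact: cvg_cst|exact: cvg_id].
by rewrite -[A]image_id -bigcup_imset1; apply: bigcup_open => z _; exact: o1.
Qed.

Hypothesis (hausdorffG : hausdorff_space G) (nondiscreteG : ~ is_discrete G).

Lemma closed_finite (A : set G) : finite_set A -> closed A.
Proof.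
by move: A; apply/accessible_finite_set_closed; exact: hausdorff_accessible.
Qed.

Lemma infinite_nondiscrete : infinite_set [set: G].
Proof.
move=> finG; apply: nondiscreteG => A; rewrite -[A]setCK openC.
by apply: closed_finite; apply: sub_finite_set finG => z.
Qed.

(** Points are closed, so removing 1 from [O] leaves an open set. Were it empty, [O] would be the
    singleton of 1 and the group discrete. *)
Lemma dense_meet_neq1 (F O : set G) : dense F -> open O -> O !=set0 ->
  exists v, [/\ F v, O v & v <> 1].
Proof.
move=> denseF openO O_neq0.
have [||v [[Ov v1] Fv]] := denseF (O `\ 1); last by exists v.
  apply: contrapT => /set0P/negP; rewrite negbK => /eqP O1.
  apply: nondiscreteG; apply: (@is_discrete_open1 1).
  rewrite (_ : [set 1] = O) //; apply/seteqP; split=> [_ ->|v Ov].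
    have [v Ov] := O_neq0; have [<-//|v1] := pselect (v = 1).
    by have : (O `\ 1) v by []; rewrite O1.
  apply: contrapT => v1; by have : (O `\ 1) v by []; rewrite O1.
apply: openI => //; rewrite openC; apply: closed_finite; exact: finite_set1.
Qed.

End TopologicalGroup.

Lemma filter_forall_seq (T : Type) (I : eqType) (D : set_system T) (s : seq I)
    (P : I -> set T) : Filter D -> (forall i, i \in s -> D (P i)) ->
  D [set t | forall i, i \in s -> P i t].
Proof.
move=> FD; elim: s => [|j s IHs] DP; first exact: nearW.
have Ds := IHs (fun i si => DP i (@mem_behead _ (j :: s) i si)).
apply: filterS2 (DP j (mem_head j s)) Ds => t Pjt Pst i.
by rewrite inE => /predU1P[->//|]; exact: Pst.
Qed.

(** * Approximation by free tuples in rank at least two *)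

Section Density.
Variables (G : topologicalGroupType) (K : eqType) (f : K -> G) (x y : K).
Hypotheses (hausdorffG : hausdorff_space G) (nondiscreteG : ~ is_discrete G).
Hypotheses (free_f : freely_generates f) (xy : x != y).
Hypothesis dense_f : dense (generated_subgroup (range f)).
Local Open Scope group_scope.

Lemma small_perturbation (a u u' : word K) (O : set G) :
  open O -> O (word_eval f a) -> u <> [::] -> u' <> [::] ->
  sorted (@nocancel K) u -> sorted (@nocancel K) u' ->
  exists m m' : word K, [/\ m <> [::] /\ m' <> [::],
    sorted (@nocancel K) (u ++ m ++ winv u),
    sorted (@nocancel K) (u' ++ m' ++ winv u') &
    O (word_eval f ((u ++ m ++ winv u) ++ a ++ (u' ++ m' ++ winv u')))].
Proof.
move=> oO Oa u0 u'0 su su'.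
pose cj w q v := word_eval f (rcons w q) * v * (word_eval f (rcons w q))^-1.
have cj_cvg w q : cj w q v @[v --> (1 : G)] --> (1 : G).
  rewrite -[in X in _ --> X](mulgV (word_eval f (rcons w q))).
  apply: mulg_cvg; last exact: cvg_cst.
  rewrite -[in X in _ --> X](mulg1 (word_eval f (rcons w q))).
  by apply: mulg_cvg; [exact: cvg_cst|exact: cvg_id].
pose letters := [:: (x, false); (x, true); (y, false); (y, true)].
(* The letters that keep the conjugates reduced depend on [v], so all sixteen pairs are controlled
   before [v] is chosen. *)
pose A := [set v | forall q, q \in letters -> forall q', q' \in letters ->
  O (cj u q v * word_eval f a * cj u' q' v)].
have nA : nbhs (1 : G) A.
  apply: filter_forall_seq => q _; apply: filter_forall_seq => q' _.
  have: cj u q v * word_eval f a * cj u' q' v @[v --> (1 : G)] -->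
      1 * word_eval f a * 1.
    by apply: mulg_cvg => //; apply: mulg_cvg => //; exact: cvg_cst.
  by rewrite mul1g mulg1; apply; exact: open_nbhs_nbhs.
have [|v [Fv Av v1]] :=
  dense_meet_neq1 hausdorffG nondiscreteG dense_f (open_interior A).
  by exists 1.
have [w0 w0v] := generated_word_eval Fv.
have [w sw wv] := word_eval_sorted f w0.
have w_neq0 : w <> [::].
  by move=> w_eq0; apply: v1; rewrite -w0v -wv w_eq0 word_eval_nil.
have conj_letter u1 : u1 <> [::] -> sorted (@nocancel K) u1 ->
    exists q m, [/\ q \in letters, m <> [::],
      sorted (@nocancel K) (u1 ++ m ++ winv u1) &
      word_eval f (u1 ++ m ++ winv u1) = cj u1 q v].
  case/lastP: u1 => // u1 l _ su1.
  have [q q4 sq] := reduced_conjugation xy su1 w_neq0 sw.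
  exists q, (q :: rcons w (linv q)); split=> //.
  rewrite /cj -w0v -wv -word_eval_winv -!word_eval_cat; congr word_eval.
  by rewrite (winv_rcons _ q) -!cats1 /= -!catA.
have [q [m [q4 m0 sm Em]]] := conj_letter u u0 su.
have [q' [m' [q'4 m'0 sm' Em']]] := conj_letter u' u'0 su'.
exists m, m'; split=> //.
rewrite word_eval_cat [word_eval f (a ++ _)]word_eval_cat Em Em' mulgA.
exact: (interior_subset Av).
Qed.

(** The index type [L] need not be that of the generators: a prefix code indexed by [L] suffices,
    which covers both tuples of length the rank and sequences. *)
Lemma dense_free_tuples (L : Type) (d : L -> seq K) :
  (forall i j u v, d i ++ u = d j ++ v -> i = j) -> dense (@free_tuples L G).
Proof.
move=> d_code O [g Og] oO.
have [s [U [oU UO]]] := nbhs_ptws_box (open_nbhs_nbhs (conj oO Og)).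
pose V j : set G := if (j : {classic L}) \in s then U j else setT.
have oV j : open (V j) by rewrite /V; case: ifP => _; [have [] := oU j|exact: openT].
(* Empty words off the finite set [s] give all lengths a common bound, even for infinite [L]. *)
have /choice[a Va] j : exists w, V j (word_eval f w) /\
    ((j : {classic L}) \notin s -> w = [::]).
  rewrite /V; case: ifPn => js; last by exists [::].
  have [o Ugj] := oU j.
  have [|v [Uv /generated_word_eval[w wv]]] := dense_f _ o; first by exists (g j).
  by exists w; rewrite wv.
pose n := (\max_(j <- s) size (a j)).+1.
have a_lt j : size (a j) < n.
  have [js|js] := boolP ((j : {classic L}) \in s); first exact: leq_bigmax_seq.
  by rewrite (Va j).2.
have /choice[m mP] j : exists m : word K * word K,
    [/\ m.1 <> [::] /\ m.2 <> [::],
      sorted (@nocancel K) (conjugated x y d n (j, false) m.1),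
      sorted (@nocancel K) (conjugated x y d n (j, true) m.2) &
      V j (word_eval f (conjugated x y d n (j, false) m.1 ++ a j ++
                        conjugated x y d n (j, true) m.2))].
  have [||||m [m' [m0 sm sm' Vm]]] := @small_perturbation (a j)
    (cylinder x y d n (j, false)) (cylinder x y d n (j, true)) _ (oV j) (Va j).1.
  - exact: cylinder_neq0.
  - exact: cylinder_neq0.
  - exact: cylinder_sorted.
  - exact: cylinder_sorted.
  by exists (m, m').
pose mm (k : L * bool) := if k.2 then (m k.1).2 else (m k.1).1.
exists (fun j => word_eval f (perturbed x y d n mm a j)); split.
  apply: UO => j js; have [_ _ _] := mP j.
  by rewrite /V js.
apply: (perturbed_free xy d_code free_f a_lt) => -[j []] /=.
- by have [[]] := mP j.
- by have [[]] := mP j.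
- by have [] := mP j.
- by have [] := mP j.
Qed.

End Density.

(** * Rank one *)

Lemma rank1_free (G : groupType) (K : Type) (f : K -> G) (k : K) (v : G) :
  (forall i, i = k) -> freely_generates f ->
  generated_subgroup (range f) v -> v <> 1%g -> freely_generates (fun _ : K => v).
Proof.
move=> Kk free_f Fv v1.
have [w0 w0v] := @generated_word_eval {classic K} _ _ _ Fv.
have [w sw wv] := @word_eval_sorted {classic K} _ f w0.
(* Over a single generator, a reduced word is a power of one letter. *)
have sorted_nseq (u : word {classic K}) : sorted (@nocancel {classic K}) u ->
    exists n b, u = nseq n (k, b).
  elim: u => [|[i b] u IHu] su; first by exists 0%N, false.
  have [n [b' uE]] := IHu (path_sorted su); exists n.+1, b.
  rewrite (Kk i) uE /=; congr (_ :: _).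
  case: n uE su => // n -> /= /andP[+ _].
  by rewrite (Kk i) /nocancel /linv xpair_eqE eqxx; case: b b' => [] [].
have red_nseq n b : reduced (nseq n (k, b) : word K).
  apply/(@reducedP {classic K}); elim: n => //= -[|n] //= ->.
  by rewrite andbT /nocancel /linv xpair_eqE eqxx; case: b.
have [p [b wE]] := sorted_nseq w sw.
move=> u /(@reducedP {classic K})/sorted_nseq[q [c uE]] u0.
pose W (_ : K) : word {classic K} := w.
have -> : word_eval (fun=> v) u = word_eval (fun j => word_eval f (W j)) u.
  by rewrite /W wv w0v.
rewrite (@word_eval_subst {classic K}).
(* Substitution multiplies exponents, and a product of nonzero exponents is nonzero. *)
have [c' ->] : exists c', flatten (map (subst W) u) = nseq (q * p) (k, c').
  have [c' E] : exists c', subst W (k, c) = nseq p (k, c').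
    rewrite /subst /W wE /=; case: c {uE} => /=; last by exists b.
    by exists (~~ b); rewrite /winv map_nseq rev_nseq.
  exists c'; rewrite uE map_nseq E; elim: (q) => //= r ->.
  by rewrite mulSn nseqD.
apply: free_f; first exact: red_nseq.
have p_gt0 : 0 < p.
  by rewrite lt0n; apply/eqP => p0; apply: v1; rewrite -w0v -wv wE p0 word_eval_nil.
have q_gt0 : 0 < q by rewrite lt0n; apply/eqP => q0; apply: u0; rewrite uE q0.
by move/(congr1 size); rewrite size_nseq /=; lia.
Qed.

Lemma dense_free_tuples1 (G : topologicalGroupType) (K : Type) (f : K -> G) (k : K) :
  hausdorff_space G -> ~ is_discrete G -> (forall i, i = k) ->
  freely_generates f -> dense (generated_subgroup (range f)) ->
  dense (@free_tuples K G).
Proof.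
move=> hausdorffG nondiscreteG Kk free_f dense_f O [g Og] oO.
have [s [U [oU UO]]] := nbhs_ptws_box (open_nbhs_nbhs (conj oO Og)).
have [oUk Uk] := oU k.
have [|v [Fv Uv v1]] := dense_meet_neq1 hausdorffG nondiscreteG dense_f oUk.
  by exists (g k).
exists (fun=> v); split; last exact: rank1_free Kk free_f Fv v1.
by apply: UO => i _; rewrite (Kk i).
Qed.

(** * Choice of the prefix codes *)

Theorem corollary14 (G : topologicalGroupType) (K : Type) (F : set G)
    (hausdorffG : hausdorff_space G) (nondiscreteG : ~ is_discrete G)
    (K_gt0 : [set: K] !=set0)
    (denseF : dense F) (freeF : free_subgroup_of_rank K F) :
  almost_free K G /\
  (`I_2 #<= [set: K] -> [set: K] #<= [set: nat] -> almost_countably_free G).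
Proof.
have infG := infinite_nondiscrete hausdorffG nondiscreteG.
have [f [free_f FE]] := freeF; rewrite {}FE in denseF.
split=> [|/card_leP[h] _]; split=> //.
  have [k _] := K_gt0.
  have [Kk|] := pselect (forall i, i = k); first exact: dense_free_tuples1 denseF.
  move=> /existsNP[x xk].
  have {}xk : (x : {classic K}) != k by exact/eqP.
  (* The one-letter words form a prefix code indexed by the generators. *)
  apply: (@dense_free_tuples G {classic K} f x k _ _ _ _ _ K (fun i => [:: i])) => //.
  by move=> i j u v [].
have i0 : 0%N \in `I_2 by apply/mem_set.
have i1 : 1%N \in `I_2 by apply/mem_set.
set x := val (h (SigSub i0)); set y := val (h (SigSub i1)).
have xy : (x : {classic K}) != y.
  apply/eqP => /val_inj /(@inj _ _ _ h) E.
  suff: 0%N = 1%N by [].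
  by apply: (congr1 val (E _ _)); rewrite in_setT.
(* The words x^i y form an infinite prefix code on two generators. *)
apply: (@dense_free_tuples G {classic K} f _ _ _ _ _ xy _ nat
  (fun i => nseq i x ++ [:: y])) => // i j u v.
rewrite -!catA /=; elim: i j => [|i IHi] [|j] //= [].
- by move=> E; rewrite E eqxx in xy.
- by move=> E; rewrite E eqxx in xy.
- by move=> /IHi ->.
Qed.
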